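(* Let $H$ be a real Hilbert space, $\mathbb B_H=\{x\in H:|x|<1\}$, and let $F:\mathbb D\to\mathbb B_H$ be harmonic with $F(0)=0$. Then $$\|dF_0\|\le\frac4\pi .$$ The constant is sharp in every nonzero Hilbert space $H$.
   Context: $\mathbb D$ is the open unit disk in $\mathbb C$. A $C^2$ map $F:\mathbb D\to H$ is harmonic if $\Delta F=0$. $\|dF_0\|$ is the operator norm of the real differential $dF_0:\mathbb R^2\to H$. *)

(* Defs.v *)
From HB Require Import structures.
From mathcomp Require Import all_boot all_order all_algebra.
From mathcomp Require Import all_classical all_reals all_analysis.

Set Implicit Arguments.
Unset Strict Implicit.
Unset Printing Implicit Defensive.
Import Order.TTheory GRing.Theory Num.Theory.
Import numFieldNormedType.Exports.

Local Open Scope classical_set_scope.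
Local Open Scope ring_scope.

(* The complex plane is represented by R * R. Its library norm is the max norm,
   so the Euclidean norm is written out below; the topology, the derivatives
   and the differential do not depend on this choice. *)

Definition unit_disk (R : realType) : set (R * R) :=
  [set z | z.1 ^+ 2 + z.2 ^+ 2 < 1].

(* Functions on an open set U are total functions of which only the values on U
   matter: for U open, the conditions below depend only on the restriction to U. *)

Definition partial_x (R : realType) (H : normedModType R) (f : R * R -> H) :
  R * R -> H := 'D_((1, 0) : R * R) f.

Definition partial_y (R : realType) (H : normedModType R) (f : R * R -> H) :
  R * R -> H := 'D_((0, 1) : R * R) f.

Fixpoint Ck_on (R : realType) (H : normedModType R) (k : nat)
    (U : set (R * R)) (f : R * R -> H) : Prop :=
  (forall z, U z -> {for z, continuous f}) /\
  if k is k'.+1 then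
    [/\ forall z, U z -> derivable f z (1, 0),
        forall z, U z -> derivable f z (0, 1),
        Ck_on k' U (partial_x f) &
        Ck_on k' U (partial_y f)]
  else True.

Definition laplacian (R : realType) (H : normedModType R) (f : R * R -> H) :
    R * R -> H :=
  fun z => partial_x (partial_x f) z + partial_y (partial_y f) z.

Definition harmonic_on (R : realType) (H : normedModType R) (U : set (R * R))
    (f : R * R -> H) : Prop :=
  Ck_on 2 U f /\ forall z, U z -> laplacian f z = 0.

(* Operator norm with respect to the Euclidean norm on the plane; the set is
   bounded whenever L is linear. *)
Definition op_norm (R : realType) (H : normedModType R) (L : R * R -> H) : R :=
  sup [set `|L v| | v in [set v : R * R | v.1 ^+ 2 + v.2 ^+ 2 <= 1]].

(* Main.v *)
Require Import Defs.
From HB Require Import structures.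
From mathcomp Require Import all_boot all_order all_algebra.
From mathcomp Require Import all_classical all_reals all_analysis.
From mathcomp Require Import ring lra.
Import Order.TTheory GRing.Theory Num.Theory.
Import numFieldNormedType.Exports.
Local Open Scope classical_set_scope.
Local Open Scope ring_scope.

(** Composing with a norming functional of the Hilbert space turns the bound
    into a statement about real harmonic functions, and that statement follows
    from the maximum principle by comparison with an explicit function.

    Fix a vector [v] of Euclidean norm at most [1], let [x] be the image of [v]
    under the differential at [0], and let [l] be a functional of norm at most
    [1] with [l x = |x|] ([hilbert_norming]). For [0 < r < 1], put the second
    coordinate axis along [v], dilate by [r], and take half the difference of
    [l o F] and of its mirror image across the line orthogonal to [v]. The
    result [w] is harmonic near the closed unit disk ([harmonic_on_frame]),
    satisfies [|w| < 1] there and vanishes on the real diameter; its partial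
    derivative in the second variable [t] is [r |x|] at [0].

    The competitor is the harmonic measure of the half circle in the upper half
    disk, extended oddly: [extremal (s, t) = 2 / pi * atan (2 t / (1 - s^2 - t^2))]. It is
    harmonic in the disk ([harmonic_extremal]), vanishes on the real diameter
    and tends to [1] on the open upper half circle, so that
    [w <= extremal] on the upper half disk ([half_disk_comparison]). Both sides
    vanish at [0], hence the inequality passes to the derivatives in [t] at [0],
    and the one of [extremal] is [4 / pi] ([odd_harmonic_derivative]). Letting
    [r] tend to [1] gives [|x| <= 4 / pi].

    The same function proves sharpness: a unit vector times [extremal] satisfies
    all hypotheses and has differential of norm [4 / pi] at [0]
    ([extremal_multiple_sharp]).

    The change of coordinates requires that second derivatives along rotated
    axes be expressed by the partial derivatives. This is the chain rule for
    maps with continuous partial derivatives ([Ck_on1_is_diff]), applied to [F]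
    and then to its partial derivatives; the mixed terms cancel for a conformal
    frame. *)

Set Implicit Arguments.
Unset Strict Implicit.

(** * Norming functionals *)

(** The trace of the Hilbert structure that the proof uses: each vector has its
    norm attained by a linear functional of norm at most [1]. *)
Definition norming (R : realType) (H : normedModType R) := forall y : H, exists l : {linear H -> R},
  (forall x, `|l x| <= `|x|) /\ l y = `|y|.

(** The functional is the inner product with the unit vector in the direction
    of [y]; its norm bound is the Cauchy-Schwarz inequality, obtained by
    expanding the square norm of [|y|^2 x - <x, y> y]. *)
Lemma hilbert_norming (R : realType) (H : completeNormedModType R)
    (dot : {dot H for idfun}) (dot_norm : forall x : H, `|x| ^+ 2 = dot x x) : norming H.
Proof.
move=> y.
have dotC x : dot y x = dot x y.
  by rewrite (hermC dot) expr0 mul1r.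
have dl : linear (fun x => dot x (`|y|^-1 *: y) : R).
  by move=> a u v; rewrite linearPl.
pose m := GRing.isLinear.Build _ _ _ _ _ dl.
pose l : {linear H -> R} := HB.pack (fun x => dot x (`|y|^-1 *: y) : R) m.
exists l.
have lE x : l x = `|y|^-1 * dot x y.
  by rewrite /l /= linearZr_LR.
have [yE|y0] := eqVneq y 0.
  split=> [x|]; last by rewrite yE linear0 normr0.
  by rewrite lE yE normr0 invr0 mul0r normr0.
have ny : 0 < `|y| by rewrite normr_gt0.
split=> [x|]; rewrite lE; last by rewrite -dot_norm expr2 mulrA mulVf ?mul1r// gt_eqF.
rewrite normrM normfV normr_id ler_pdivrMl//.
rewrite -ler_sqr ?nnegrE ?mulr_ge0// real_normK ?num_real// exprMn.
have := sqr_ge0 `| `|y| ^+ 2 *: x - dot x y *: y|.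
rewrite dot_norm linearBl linearBr /= linearBr /=.
rewrite !linearZl_LR /= !linearZr_LR /= -!dot_norm dotC.
set d := dot x y; set X := `|x|; set Y := `|y|.
have Y2 : 0 < Y ^+ 2 by rewrite exprn_gt0.
rewrite /GRing.scale /= => h.
rewrite -subr_ge0 -(pmulr_rge0 _ Y2).
by apply: le_trans h _; rewrite le_eqVlt; apply/orP; left; apply/eqP; ring.
Qed.

(** * Derivatives along lines and the mean value theorem *)

Lemma derive_of (R : realType) (V W : normedModType R) (f : V -> W) (x v : V) (df : W) :
  is_derive x v f df -> 'D_v f x = df.
Proof. by case. Qed.

Lemma is_derive_along (R : realType) (V W : normedModType R) (f : V -> W) (x v : V) (s : R) :
  derivable f (s *: v + x) v ->
  is_derive s 1 (fun t : R => f (t *: v + x)) ('D_v f (s *: v + x)).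
Proof.
move=> df.
have E : (fun h : R => h^-1 *: ((fun t : R => f (t *: v + x)) (h *: 1 + s) - f (s *: v + x))) =
  (fun h : R => h^-1 *: (f (h *: v + (s *: v + x)) - f (s *: v + x))).
  by apply/funext => h; rewrite [h *: 1]mulr1 scalerDl addrA.
by split; rewrite /derivable /derive /= E.
Qed.

Lemma is_derive_linear_comp (R : realType) (V W W' : normedModType R) (l : {linear W -> W'})
   (f : V -> W) (x v : V) : continuous l ->
  derivable f x v -> is_derive x v (l \o f) (l ('D_v f x)).
Proof.
move=> lc df.
have E : (fun h : R => h^-1 *: ((l \o f) (h *: v + x) - (l \o f) x)) =
  l \o (fun h : R => h^-1 *: (f (h *: v + x) - f x)).
  by rewrite funeqE => h /=; rewrite [RHS]linearZ [in RHS]linearB.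
have lim_l : (l \o (fun h : R => h^-1 *: (f (h *: v + x) - f x))) @ 0^' --> l ('D_v f x).
  by apply: continuous_cvg; [apply: lc|exact: df].
split; rewrite /derivable /derive /= E; last exact: cvg_lim.
by apply/cvg_ex; exists (l ('D_v f x)).
Qed.

(** The sign of [c] is left free so that increments into all four quadrants are
    treated at once. *)
Lemma MVT_either_side (R : realType) (f df : R -> R) (c : R) :
  (forall t : R, `|t| <= `|c| -> is_derive t 1 f (df t)) ->
  exists2 t, `|t| <= `|c| & f c - f 0 = df t * c.
Proof.
move=> fd.
have fc (a b : R) : (forall t, a <= t <= b -> `|t| <= `|c|) -> {within `[a, b], continuous f}.
  move=> h; apply: derivable_within_continuous => t /[!in_itv]/= /h /fd d.
  exact: ex_derive.
have [c0|/ltW c0] := leP 0 c.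
  have cE : forall t, 0 <= t <= c -> `|t| <= `|c|.
    by move=> t /andP[t0 tc]; rewrite !ger0_norm.
  have [t tc ->] := @MVT_segment R f df 0 c c0
    (fun t tc => fd t (cE t (subset_itv_oo_cc tc))) (fc _ _ cE).
  by exists t; [apply: cE|rewrite subr0].
have cE : forall t, c <= t <= 0 -> `|t| <= `|c|.
  by move=> t /andP[t0 tc]; rewrite !ler0_norm// lerN2.
have [t tc E] := @MVT_segment R f df c 0 c0
    (fun t tc => fd t (cE t (subset_itv_oo_cc tc))) (fc _ _ cE).
by exists t; [apply: cE|rewrite -opprB E sub0r mulrN opprK].
Qed.

(** * Maps with continuous partial derivatives are differentiable *)

Lemma continuous_fst (U V : topologicalType) : continuous (@fst U V).
Proof. by move=> x; exact: cvg_fst. Qed.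

Lemma continuous_snd (U V : topologicalType) : continuous (@snd U V).
Proof. by move=> x; exact: cvg_snd. Qed.

Lemma is_diff_of_increment (R : realType) (V W : normedModType R) (f : V -> W) (z : V)
    (L : {linear V -> W}) : continuous L ->
  (forall eps : R, 0 < eps ->
    \forall h \near (0 : V), `|f (h + z) - f z - L h| <= eps * `|h|) ->
  is_diff z f L.
Proof.
move=> Lc incr.
have fo : f \o shift z = cst (f z) + L +o_ 0 id.
  apply/eqaddoP => _/posnumP[eps].
  near=> h; rewrite /= !fctE /= opprD addrA.
  by near: h; exact: incr.
have dfL : 'd f z = L :> (V -> W) by exact: diff_unique.
by apply: DiffDef => //; apply/diff_locallyP; rewrite dfL.
Unshelve. all: by end_near. Qed.

Lemma continuous_contraction (R : realType) (V W : normedModType R) (l : {linear V -> W}) :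
  (forall x, `|l x| <= `|x|) -> continuous l.
Proof.
move=> l1; apply/linear_bounded_continuous/linear_boundedP.
by near=> r => y; apply: le_trans (l1 y) _; apply: ler_peMl => //; near: r; exact: nbhs_pinfty_ge.
Unshelve. all: by end_near. Qed.

(** The mean value theorem fails for vector-valued maps, but it holds after
    composition with one functional. Applied with the functional that norms the
    increment itself, this estimate bounds the increment in [W]. *)
Lemma mean_value_bound (R : realType) (V W : normedModType R) (f : V -> W) (x v : V)
   (a : W) (c e : R) (l : {linear W -> R}) :
  (forall y, `|l y| <= `|y|) ->
  (forall t : R, `|t| <= `|c| -> derivable f (t *: v + x) v) ->
  (forall t : R, `|t| <= `|c| -> `|'D_v f (t *: v + x) - a| <= e) ->
  `|l (f (c *: v + x) - f x - c *: a)| <= `|c| * e.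
Proof.
move=> l1 df dfa.
have lc := continuous_contraction l1.
pose g t := l (f (t *: v + x)).
have gd (t : R) : `|t| <= `|c| -> is_derive t 1 g (l ('D_v f (t *: v + x))).
  move=> tc; have h := is_derive_along (df t tc).
  rewrite -(derive_of h).
  exact: is_derive_linear_comp.
have [t tc E] := MVT_either_side gd.
rewrite !linearB /= linearZ /=.
have -> : f x = f (0 *: v + x) by rewrite scale0r add0r.
rewrite -/(g c) -/(g 0) E mulrC -mulrBr -linearB normrM.
by apply: ler_wpM2l => //; apply: le_trans (l1 _) (dfa _ tc).
Qed.

(** The increment is split along a horizontal and a vertical segment; on each of
    them the partial derivative stays close to its value at [z]. *)
Lemma Ck_on1_is_diff (R : realType) (H : normedModType R) (U : set (R * R)) (f : R * R -> H) z :
  norming H -> open U -> Ck_on 1 U f -> U z ->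
  is_diff z f (fun h => h.1 *: partial_x f z + h.2 *: partial_y f z).
Proof.
move=> nH oU [_ [dx dy [cx _] [cy _]]] Uz.
set a := partial_x f z; set b := partial_y f z.
have linL : linear (fun h : R * R => h.1 *: a + h.2 *: b).
  by move=> k u v; rewrite [LHS]/= !scalerDl scalerDr !scalerA addrACA.
pose m := GRing.isLinear.Build _ _ _ _ _ linL.
pose L : {linear (R * R)%type -> H} := HB.pack (fun h : R * R => h.1 *: a + h.2 *: b) m.
apply: (@is_diff_of_increment _ _ _ _ _ L).
  move=> x; apply: cvgD; apply: cvgZr_tmp; [exact: continuous_fst|exact: continuous_snd].
move=> eps eps0.
have e2 : 0 < eps / 2 by rewrite divr_gt0.
have /nbhs_ballP[d /= d0 dP] : \forall y \near z, [/\ U y, `|partial_x f y - a| <= eps / 2 &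
      `|partial_y f y - b| <= eps / 2].
  have /cvgrPdist_le/(_ _ e2) nx : partial_x f y @[y --> z] --> a := cx _ Uz.
  have /cvgrPdist_le/(_ _ e2) ny : partial_y f y @[y --> z] --> b := cy _ Uz.
  apply: filterS3 nx ny (open_nbhs_nbhs (conj oU Uz)) => y hx hy Uy.
  by split; rewrite // distrC.
apply/nbhs_norm0P; exists d => //= h hd.
have inD (s t : R) : `|s| <= `|h.1| -> `|t| <= `|h.2| -> ball z d (s + z.1, t + z.2).
  move=> sh th; have : `|h.1| < d /\ `|h.2| < d.
    by move: hd; rewrite /= prod_normE gt_max => /andP.
  move=> [h1 h2]; split => /=.
    by rewrite /ball/= opprD addrCA subrr addr0 normrN (le_lt_trans sh).
  by rewrite /ball/= opprD addrCA subrr addr0 normrN (le_lt_trans th).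
have [l [l1 le]] := nH (f (h + z) - f z - L h).
rewrite -le.
pose y : R * R := (z.1, h.2 + z.2).
have ptx (t : R) : t *: ((1, 0) : R * R) + y = (t + z.1, h.2 + z.2).
  by rewrite /y /GRing.scale /= /GRing.add /= /add_pair /= /GRing.scale /= mulr1 mulr0 add0r.
have pty (t : R) : t *: ((0, 1) : R * R) + z = (0 + z.1, t + z.2).
  by rewrite /GRing.scale /= [LHS]/GRing.add /= /add_pair /= /GRing.scale /= mulr1 mulr0.
have Bx := @mean_value_bound _ _ _ f y (1, 0) a h.1 (eps / 2) l l1.
have By := @mean_value_bound _ _ _ f z (0, 1) b h.2 (eps / 2) l l1.
have -> : f (h + z) - f z - L h = (f (h.1 *: (1, 0) + y) - f y - h.1 *: a)
     + (f (h.2 *: (0, 1) + z) - f z - h.2 *: b).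
  rewrite ptx pty add0r.
  have -> : (z.1, h.2 + z.2) = y by [].
  have -> : (h.1 + z.1, h.2 + z.2) = h + z by [].
  by rewrite -[L h]/(h.1 *: a + h.2 *: b) [RHS]addrACA subrKA opprD.
rewrite linearD; apply: le_trans (ler_norm _) _; apply: le_trans (ler_normD _ _) _.
have h0 : `|0 : R| <= `|h.1| by rewrite normr0.
have hE1 : `|h.1| <= `|h| by rewrite prod_normE le_max lexx.
have hE2 : `|h.2| <= `|h| by rewrite prod_normE le_max lexx orbT.
rewrite [eps]splitr mulrDl; apply: lerD.
  apply: le_trans (Bx _ _) _; last by rewrite mulrC ler_wpM2l// ltW.
  - by move=> t tc; rewrite ptx; apply: dx; case: (dP _ (inD t h.2 tc (lexx _))).
  - by move=> t tc; rewrite ptx; case: (dP _ (inD t h.2 tc (lexx _))).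
apply: le_trans (By _ _) _; last by rewrite mulrC ler_wpM2l// ltW.
- by move=> t tc; rewrite pty; apply: dy; case: (dP _ (inD 0 t h0 tc)).
- by move=> t tc; rewrite pty; case: (dP _ (inD 0 t h0 tc)).
Qed.

(** * Closure properties of C^k maps *)

Lemma Ck_on1_is_derive (R : realType) (H : normedModType R) (U : set (R * R)) (f : R * R -> H) z v :
  norming H -> open U -> Ck_on 1 U f -> U z ->
  is_derive z v f (v.1 *: partial_x f z + v.2 *: partial_y f z).
Proof.
move=> nH oU f1 Uz; have d := Ck_on1_is_diff nH oU f1 Uz.
have df : differentiable f z by exact: ex_diff.
by split; [exact: diff_derivable|rewrite deriveE// (@diff_val _ _ _ _ _ _ _ d)].
Qed.

Lemma Ck_onS_le1 (R : realType) (H : normedModType R) (k : nat) (U : set (R * R)) (f : R * R -> H) :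
  Ck_on k.+1 U f -> Ck_on 1 U f.
Proof.
move=> [cf [dx dy fx fy]]; split; first exact: cf.
by split; [exact: dx|exact: dy|case: k fx {fy} => [|k] []|case: k fy {fx} => [|k] []].
Qed.

Lemma open_near_eq (T : topologicalType) (S : Type) (U : set T) (f g : T -> S) (z : T) :
  open U -> U z -> (forall y, U y -> f y = g y) -> {near z, f =1 g}.
Proof. by move=> oU Uz fg; apply: filterS (open_nbhs_nbhs (conj oU Uz)) => y; exact: fg. Qed.

Lemma eq_Ck_on (R : realType) (H : normedModType R) (k : nat) (U : set (R * R)) (f g : R * R -> H) :
  open U -> (forall z, U z -> f z = g z) -> Ck_on k U f -> Ck_on k U g.
Proof.
move=> oU; elim: k f g => [|k IH] f g fg.
all: have fgn z : U z -> {near z, f =1 g} by move=> Uz; exact: open_near_eq oU Uz fg.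
all: have cg : (forall z, U z -> {for z, continuous f}) -> forall z, U z -> {for z, continuous g} by
  move=> cf z Uz; rewrite /prop_for /continuous_at -(fg _ Uz);
  apply: cvg_trans (cf z Uz); apply: near_eq_cvg; exact: fgn.
  by move=> [cf _]; split => //; exact: cg.
move=> [cf [dx dy fx fy]]; split; first exact: cg.
split.
- by move=> z Uz; apply: near_eq_derivable (fgn _ Uz) (dx z Uz).
- by move=> z Uz; apply: near_eq_derivable (fgn _ Uz) (dy z Uz).
- by apply: IH fx => z Uz; apply: near_eq_derive (fgn _ Uz).
- by apply: IH fy => z Uz; apply: near_eq_derive (fgn _ Uz).
Qed.

Lemma is_derive_lincomb (R : realType) (V W : normedModType R) (f g : V -> W) (d e : R) (x v : V) :
  derivable f x v -> derivable g x v ->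
  is_derive x v (d *: f + e *: g) (d *: 'D_v f x + e *: 'D_v g x).
Proof. by move=> /derivableP df /derivableP dg; exact: is_deriveD. Qed.

Lemma Ck_on_lincomb (R : realType) (H : normedModType R) (k : nat) (U : set (R * R))
    (a b : R) (f g : R * R -> H) :
  open U -> Ck_on k U f -> Ck_on k U g -> Ck_on k U (a *: f + b *: g).
Proof.
move=> oU; elim: k f g => [|k IH] f g [cf fk] [cg gk].
all: have cfg : forall z, U z -> {for z, continuous (a *: f + b *: g)} by
  move=> z Uz; apply: cvgD; apply: cvgZl_tmp; [exact: cf|exact: cg].
  by split.
case: fk gk => dfx dfy fx fy [dgx dgy gx gy]; split; first exact: cfg.
have dx z : U z -> _ := fun Uz => is_derive_lincomb a b (dfx z Uz) (dgx z Uz).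
have dy z : U z -> _ := fun Uz => is_derive_lincomb a b (dfy z Uz) (dgy z Uz).
split.
- by move=> z Uz; have := dx _ Uz => ?; exact: ex_derive.
- by move=> z Uz; have := dy _ Uz => ?; exact: ex_derive.
- apply: eq_Ck_on (IH _ _ fx gx) => // z Uz.
  exact: esym (derive_of (dx _ Uz)).
- apply: eq_Ck_on (IH _ _ fy gy) => // z Uz.
  exact: esym (derive_of (dy _ Uz)).
Qed.

Lemma Ck_on_linear_comp (R : realType) (H H' : normedModType R) (k : nat) (U : set (R * R))
    (l : {linear H -> H'}) (f : R * R -> H) :
  continuous l -> open U -> Ck_on k U f -> Ck_on k U (l \o f).
Proof.
move=> lc oU; elim: k f => [|k IH] f [cf fk].
all: have clf : forall z, U z -> {for z, continuous (l \o f)} by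
  move=> z Uz; apply: continuous_comp; [exact: cf|exact: lc].
  by split.
case: fk => dx dy fx fy; split; first exact: clf.
split.
- by move=> z Uz; have := is_derive_linear_comp lc (dx z Uz) => ?; exact: ex_derive.
- by move=> z Uz; have := is_derive_linear_comp lc (dy z Uz) => ?; exact: ex_derive.
- apply: eq_Ck_on (IH _ fx) => // z Uz.
  by have h := is_derive_linear_comp lc (dx z Uz); rewrite /partial_x (derive_of h).
- apply: eq_Ck_on (IH _ fy) => // z Uz.
  by have h := is_derive_linear_comp lc (dy z Uz); rewrite /partial_y (derive_of h).
Qed.

(** * Linear changes of coordinates *)

Lemma is_derive_comp_affine (R : realType) (V V' W : normedModType R) (f : V' -> W) (T : V -> V')
    (z v : V) (w : V') :
  (forall h : R, T (h *: v + z) = h *: w + T z) -> derivable f (T z) w ->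
  is_derive z v (f \o T) ('D_w f (T z)).
Proof.
move=> Tw df.
have E : (fun h : R => h^-1 *: ((f \o T) (h *: v + z) - (f \o T) z)) =
         (fun h : R => h^-1 *: (f (h *: w + T z) - f (T z))).
  by rewrite funeqE => h; rewrite /= Tw.
by split; rewrite /derivable /derive /= E.
Qed.

(** The linear map of the plane that sends the canonical basis to [(a, b)]. *)
Definition frame (R : realType) (a b z : R * R) : R * R := z.1 *: a + z.2 *: b.

Lemma continuous_frame (R : realType) (a b : R * R) : continuous (frame a b).
Proof.
move=> z; apply: cvgD; apply: cvgZr_tmp; [exact: continuous_fst|exact: continuous_snd].
Qed.

Lemma is_derive_frame_x (R : realType) (H : normedModType R) (f : R * R -> H) (a b z : R * R) :
  derivable f (frame a b z) a ->
  is_derive z ((1, 0) : R * R) (f \o frame a b) ('D_a f (frame a b z)).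
Proof.
apply: is_derive_comp_affine => h.
by rewrite /frame /= !scalerDl [h *: 1]mulr1 [h *: 0]mulr0 scale0r add0r addrA.
Qed.

Lemma is_derive_frame_y (R : realType) (H : normedModType R) (f : R * R -> H) (a b z : R * R) :
  derivable f (frame a b z) b ->
  is_derive z ((0, 1) : R * R) (f \o frame a b) ('D_b f (frame a b z)).
Proof.
apply: is_derive_comp_affine => h.
by rewrite /frame /= !scalerDl [h *: 1]mulr1 [h *: 0]mulr0 scale0r add0r addrCA.
Qed.

(** The algebra behind the conformal invariance of the Laplacian. The mixed
    terms [xy] and [yx] cancel separately because their common coefficient is
    [a1 a2 + b1 b2]. *)
Lemma conformal_quadratic (R : comPzRingType) (H : lmodType R) (a1 a2 b1 b2 c : R)
    (xx xy yx yy : H) :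
  a1 ^+ 2 + b1 ^+ 2 = c -> a2 ^+ 2 + b2 ^+ 2 = c -> a1 * a2 + b1 * b2 = 0 ->
  a1 *: (a1 *: xx + a2 *: xy) + a2 *: (a1 *: yx + a2 *: yy) +
  (b1 *: (b1 *: xx + b2 *: xy) + b2 *: (b1 *: yx + b2 *: yy)) = c *: (xx + yy).
Proof.
move=> c1 c2 c12.
have -> : c *: (xx + yy) = (a1 ^+ 2 + b1 ^+ 2) *: xx + (a2 ^+ 2 + b2 ^+ 2) *: yy.
  by rewrite c1 c2 scalerDr.
have b12 : b1 * b2 = - (a1 * a2) by apply/eqP; rewrite -addr_eq0 addrC c12.
rewrite !scalerDr !scalerDl !scalerA -!expr2 [a2 * a1]mulrC [b2 * b1]mulrC b12 !scaleNr.
rewrite addrACA [X in X + _]addrACA [X in _ + X]addrACA !subrr addr0 add0r.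
by [].
Qed.

Section frame_comp.
Variables (R : realType) (H : normedModType R) (U V : set (R * R)) (a b : R * R).
Hypotheses (nH : norming H) (oU : open U) (oV : open V).
Hypothesis VU : forall z, V z -> U (frame a b z).

Lemma partial_x_frame (f : R * R -> H) z : Ck_on 1 U f -> V z ->
  is_derive z ((1, 0) : R * R) (f \o frame a b)
    ((a.1 *: partial_x f + a.2 *: partial_y f) (frame a b z)).
Proof.
move=> f1 /VU Uz; have d := Ck_on1_is_derive a nH oU f1 Uz.
by rewrite /= -[X in is_derive _ _ _ X](derive_of d); apply: is_derive_frame_x.
Qed.

Lemma partial_y_frame (f : R * R -> H) z : Ck_on 1 U f -> V z ->
  is_derive z ((0, 1) : R * R) (f \o frame a b)
    ((b.1 *: partial_x f + b.2 *: partial_y f) (frame a b z)).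
Proof.
move=> f1 /VU Uz; have d := Ck_on1_is_derive b nH oU f1 Uz.
by rewrite /= -[X in is_derive _ _ _ X](derive_of d); apply: is_derive_frame_y.
Qed.

Lemma Ck_on_frame k (f : R * R -> H) : Ck_on k U f -> Ck_on k V (f \o frame a b).
Proof.
elim: k f => [|k IH] f fk.
all: have cf : forall z, V z -> {for z, continuous (f \o frame a b)} by
  case: fk => cf _ z /VU Uz; apply: continuous_comp; [exact: continuous_frame|exact: cf].
  by split.
have f1 := Ck_onS_le1 fk.
case: fk => _ [dx dy fx fy]; split; first exact: cf.
have gx z : V z -> _ := partial_x_frame f1.
have gy z : V z -> _ := partial_y_frame f1.
split.
- by move=> z Vz; have := gx _ Vz => ?; exact: ex_derive.
- by move=> z Vz; have := gy _ Vz => ?; exact: ex_derive.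
- apply: eq_Ck_on (IH _ (Ck_on_lincomb a.1 a.2 oU fx fy)) => // z Vz.
  by rewrite /= -(derive_of (gx _ Vz)).
- apply: eq_Ck_on (IH _ (Ck_on_lincomb b.1 b.2 oU fx fy)) => // z Vz.
  by rewrite /= -(derive_of (gy _ Vz)).
Qed.

(** The three equations on [a] and [b] say that the frame is [sqrt c] times an
    orthogonal matrix, possibly with a reflection. *)
Lemma laplacian_frame (c : R) (f : R * R -> H) z :
  a.1 ^+ 2 + b.1 ^+ 2 = c -> a.2 ^+ 2 + b.2 ^+ 2 = c -> a.1 * a.2 + b.1 * b.2 = 0 ->
  Ck_on 2 U f -> V z -> laplacian (f \o frame a b) z = c *: laplacian f (frame a b z).
Proof.
move=> c1 c2 c12 f2 Vz; have f1 := Ck_onS_le1 f2.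
case: f2 => _ [dx dy fx fy].
have lin1 d e := @Ck_on_lincomb _ _ 1 _ d e _ _ oU fx fy.
have Uz := VU Vz.
rewrite /laplacian.
have -> : partial_x (partial_x (f \o frame a b)) z =
   (a.1 *: partial_x (a.1 *: partial_x f + a.2 *: partial_y f) +
    a.2 *: partial_y (a.1 *: partial_x f + a.2 *: partial_y f)) (frame a b z).
  rewrite -(derive_of (partial_x_frame (lin1 a.1 a.2) Vz)).
  apply: near_eq_derive; apply: open_near_eq oV Vz _ => y Vy.
  by rewrite -[RHS](derive_of (partial_x_frame f1 Vy)).
have -> : partial_y (partial_y (f \o frame a b)) z =
   (b.1 *: partial_x (b.1 *: partial_x f + b.2 *: partial_y f) +
    b.2 *: partial_y (b.1 *: partial_x f + b.2 *: partial_y f)) (frame a b z).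
  rewrite -(derive_of (partial_y_frame (lin1 b.1 b.2) Vz)).
  apply: near_eq_derive; apply: open_near_eq oV Vz _ => y Vy.
  by rewrite -[RHS](derive_of (partial_y_frame f1 Vy)).
have [[_ [fxx fxy _ _]] [_ [fyx fyy _ _]]] := (fx, fy).
have dxE d e : partial_x (d *: partial_x f + e *: partial_y f) (frame a b z) =
   d *: partial_x (partial_x f) (frame a b z) + e *: partial_x (partial_y f) (frame a b z).
  exact: (derive_of (is_derive_lincomb d e (fxx _ Uz) (fyx _ Uz))).
have dyE d e : partial_y (d *: partial_x f + e *: partial_y f) (frame a b z) =
   d *: partial_y (partial_x f) (frame a b z) + e *: partial_y (partial_y f) (frame a b z).
  exact: (derive_of (is_derive_lincomb d e (fxy _ Uz) (fyy _ Uz))).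
rewrite !fctE !dxE !dyE.
exact: conformal_quadratic.
Qed.
End frame_comp.

(** * Harmonic maps *)

Lemma laplacian_lincomb (R : realType) (H : normedModType R) (U : set (R * R)) (a b : R)
    (f g : R * R -> H) z :
  open U -> Ck_on 2 U f -> Ck_on 2 U g -> U z ->
  laplacian (a *: f + b *: g) z = a *: laplacian f z + b *: laplacian g z.
Proof.
move=> oU [_ [dfx dfy [_ [fxx _ _ _]] [_ [_ fyy _ _]]]].
move=> [_ [dgx dgy [_ [gxx _ _ _]] [_ [_ gyy _ _]]]] Uz.
have xx : partial_x (partial_x (a *: f + b *: g)) z =
    a *: partial_x (partial_x f) z + b *: partial_x (partial_x g) z.
  rewrite -(derive_of (is_derive_lincomb a b (fxx z Uz) (gxx z Uz))).
  apply: near_eq_derive; apply: open_near_eq oU Uz _ => y Uy.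
  exact: derive_of (is_derive_lincomb a b (dfx y Uy) (dgx y Uy)).
have yy : partial_y (partial_y (a *: f + b *: g)) z =
    a *: partial_y (partial_y f) z + b *: partial_y (partial_y g) z.
  rewrite -(derive_of (is_derive_lincomb a b (fyy z Uz) (gyy z Uz))).
  apply: near_eq_derive; apply: open_near_eq oU Uz _ => y Uy.
  exact: derive_of (is_derive_lincomb a b (dfy y Uy) (dgy y Uy)).
have regroup (p q r s : H) :
    a *: p + b *: q + (a *: r + b *: s) = a *: (p + r) + b *: (q + s).
  by rewrite !scalerDr addrACA.
by rewrite {1}/laplacian xx yy; exact: regroup.
Qed.

Lemma harmonic_on_lincomb (R : realType) (H : normedModType R) (U : set (R * R)) (a b : R)
    (f g : R * R -> H) :
  open U -> harmonic_on U f -> harmonic_on U g -> harmonic_on U (a *: f + b *: g).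
Proof.
move=> oU [f2 lf] [g2 lg]; split; first exact: Ck_on_lincomb.
by move=> z Uz; rewrite (laplacian_lincomb a b oU f2 g2 Uz) lf// lg// !scaler0 addr0.
Qed.

Lemma harmonic_on_linear_comp (R : realType) (H H' : normedModType R) (U : set (R * R))
    (l : {linear H -> H'}) (f : R * R -> H) :
  continuous l -> open U -> harmonic_on U f -> harmonic_on U (l \o f).
Proof.
move=> lc oU [f2 lf]; split; first exact: Ck_on_linear_comp.
case: f2 => _ [dfx dfy [_ [fxx _ _ _]] [_ [_ fyy _ _]]].
move=> z Uz.
have xx : partial_x (partial_x (l \o f)) z = l (partial_x (partial_x f) z).
  rewrite -(derive_of (is_derive_linear_comp lc (fxx z Uz))).
  apply: near_eq_derive; apply: open_near_eq oU Uz _ => y Uy.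
  exact: derive_of (is_derive_linear_comp lc (dfx y Uy)).
have yy : partial_y (partial_y (l \o f)) z = l (partial_y (partial_y f) z).
  rewrite -(derive_of (is_derive_linear_comp lc (fyy z Uz))).
  apply: near_eq_derive; apply: open_near_eq oU Uz _ => y Uy.
  exact: derive_of (is_derive_linear_comp lc (dfy y Uy)).
by rewrite /laplacian xx yy -linearD -/(laplacian f z) lf// linear0.
Qed.

Lemma harmonic_on_frame (R : realType) (H : normedModType R) (U V : set (R * R)) (a b : R * R)
    (c : R) (f : R * R -> H) :
  norming H -> open U -> open V -> (forall z, V z -> U (frame a b z)) ->
  a.1 ^+ 2 + b.1 ^+ 2 = c -> a.2 ^+ 2 + b.2 ^+ 2 = c -> a.1 * a.2 + b.1 * b.2 = 0 ->
  harmonic_on U f -> harmonic_on V (f \o frame a b).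
Proof.
move=> nH oU oV VU c1 c2 c12 [f2 lf]; split; first exact: Ck_on_frame oU oV VU _ _ f2.
move=> z Vz; rewrite (laplacian_frame nH oU oV VU c1 c2 c12 f2 Vz) lf ?scaler0//.
exact: VU.
Qed.

(** * Local maxima and the Laplacian *)

(** If the second derivative were positive, the first one, which vanishes at
    [0], would be positive just after [0], and the mean value theorem would give
    a value larger than the maximum. *)
Lemma second_derivative_test1 (R : realType) (f : R -> R) :
  (\forall t \near 0, f t <= f 0) -> (\forall t \near 0, derivable f t 1) ->
  derivable ('D_1 f) 0 1 -> 'D_1 ('D_1 f) 0 <= 0.
Proof.
move=> fmax df ddf.
have /nbhs_norm0P[e /= e0 eP] : \forall t \near 0, f t <= f 0 /\ derivable f t 1.
  by apply: filterS2 fmax df => t.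
have itvE t : t \in `]-e, e[%R -> `|t| < e by rewrite in_itv /= ltr_norml.
have f0 : 'D_1 f 0 = 0.
  apply: derive_of.
  apply: (@derive1_at_max _ f (- e) e).
  - by rewrite lerNl (le_trans _ (ltW e0))// oppr_le0 ltW.
  - by move=> t /itvE /eP[].
  - by rewrite in_itv /= oppr_lt0 e0.
  - by move=> t /itvE /eP[].
rewrite leNgt; apply/negP => fpos.
have : \forall h \near 0^', 0 < h^-1 *: ('D_1 f (h *: 1 + 0) - 'D_1 f 0).
  move: ddf; rewrite /derivable => ddf.
  exact: (cvgr_gt _ ddf).
rewrite /dnbhs near_withinE => /nbhs_norm0P[d /= d0 dP].
pose h := Num.min d e / 2.
have me0 : 0 < Num.min d e by rewrite lt_min d0.
have h0 : 0 < h by rewrite divr_gt0.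
have hme : h < Num.min d e by rewrite ltr_pdivrMr// mulr_natr mulr2n ltrDl.
have small t : 0 <= t <= h -> `|t| < Num.min d e.
  by move=> /andP[t0 th]; rewrite ger0_norm// (le_lt_trans th).
have [t tI E] : exists2 t, t \in `]0, h[%R & f h - f 0 = 'D_1 f t * (h - 0).
  apply: MVT; first exact: h0.
    move=> t /subset_itv_oo_cc /small; rewrite lt_min => /andP[_ /eP[_ dt]].
    exact: derivableP.
  apply: derivable_within_continuous => t /small; rewrite lt_min => /andP[_].
  by move=> /eP[].
have /small : 0 <= h <= h by rewrite lexx ltW.
rewrite lt_min => /andP[_ /eP[fh _]].
have t0 : 0 < t by move: tI; rewrite in_itv => /andP[].
have /small : 0 <= t <= h by exact: (subset_itv_oo_cc tI).
rewrite lt_min => /andP[/dP /(_ (lt0r_neq0 t0)) + _].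
rewrite f0 subr0 [t *: 1]mulr1 addr0 pmulr_rgt0 ?invr_gt0// => ft.
have : 0 < f h - f 0 by rewrite E subr0 mulr_gt0.
by rewrite subr_gt0 ltNge fh.
Qed.

Lemma second_derivative_test (R : realType) (V : normedModType R) (f : V -> R) (z v : V) :
  (\forall y \near z, f y <= f z) -> (\forall y \near z, derivable f y v) ->
  derivable ('D_v f) z v -> 'D_v ('D_v f) z <= 0.
Proof.
move=> fmax df ddf.
pose g (t : R) := f (t *: v + z).
have lineP (P : V -> Prop) : (\forall y \near z, P y) -> \forall t \near (0 : R), P (t *: v + z).
  have : (fun t : R => t *: v + z) @ (0 : R) --> z.
    rewrite -[X in _ --> X]add0r -[X in X + z](scale0r v).
    by apply: cvgD; [apply: cvgZr_tmp; exact: cvg_id|exact: cvg_cst].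
  by move=> + nP => /(_ _ nP).
have g1 : \forall t \near (0 : R), 'D_1 g t = 'D_v f (t *: v + z).
  have := lineP _ df; apply: filterS => t dt.
  exact: derive_of (is_derive_along dt).
have z0 : 0 *: v + z = z by rewrite scale0r add0r.
have dd0 : derivable ('D_v f) (0 *: v + z) v by rewrite z0.
have dd := is_derive_along dd0.
have g1' : \forall t \near (0 : R), 'D_v f (t *: v + z) = 'D_1 g t.
  by apply: filterS g1 => t ->.
have g2 := near_eq_is_derive g1' dd.
have <- : 'D_1 ('D_1 g) 0 = 'D_v ('D_v f) z by rewrite (derive_of g2) z0.
apply: second_derivative_test1.
- by have := lineP _ fmax; apply: filterS => t; rewrite /g z0.
- by have := lineP _ df; apply: filterS => t dt; have := is_derive_along dt => ?; exact: ex_derive.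
- exact: ex_derive.
Qed.

(** * Rational functions of the two coordinates *)

Lemma is_derive_of_line (R : realType) (V W : normedModType R) (f : V -> W) (z v : V) (df : W) :
  is_derive (0 : R) 1 (fun h : R => f (h *: v + z)) df -> is_derive z v f df.
Proof.
move=> d.
have E : (fun h : R => h^-1 *: ((fun t : R => f (t *: v + z)) (h *: 1 + 0) - f (0 *: v + z))) =
         (fun h : R => h^-1 *: (f (h *: v + z) - f z)).
  by rewrite funeqE => h; rewrite /= addr0 [h *: 1]mulr1 scale0r add0r.
by case: d; rewrite /derivable /derive /= E => ? ?; split.
Qed.

Lemma is_derive_comp1 (R : realType) (V : normedModType R) (f : V -> R) (g : R -> R) (z v : V)
    (df dg : R) :
  is_derive z v f df -> is_derive (f z) 1 g dg -> is_derive z v (fun y => g (f y)) (dg * df).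
Proof.
move=> [fd fdE] [gd gdE]; apply: is_derive_of_line.
pose k := fun h : R => f (h *: v + z).
have k0 : k 0 = f z by rewrite /k scale0r add0r.
have := @is_derive_along _ _ _ f z v 0; rewrite scale0r add0r fdE => /(_ fd) dk.
have dg0 : derivable g (k 0) 1 by rewrite k0; exact: gd.
have dkd : differentiable k 0 by apply/derivable1_diffP; exact: ex_derive.
have dgd : differentiable g (k 0) by exact/derivable1_diffP.
split; first by apply/derivable1_diffP; exact: differentiable_comp dkd dgd.
have := @derive1_comp _ k g 0 (@ex_derive _ _ _ _ _ _ _ dk) dg0; rewrite !derive1E => ->.
by rewrite k0 gdE (derive_of dk).
Qed.

Lemma is_derive_fst (R : realType) (z v : R * R) : is_derive z v (fun y : R * R => y.1) v.1.
Proof.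
apply: is_derive_of_line; have h : is_derive (0 : R) 1 (id * cst v.1 + cst z.1) v.1.
  apply: is_derive_eq; rewrite scaler0 add0r addr0.
  by rewrite /GRing.scale /= mulr1.
exact: h.
Qed.

Lemma is_derive_snd (R : realType) (z v : R * R) : is_derive z v (fun y : R * R => y.2) v.2.
Proof.
apply: is_derive_of_line; have h : is_derive (0 : R) 1 (id * cst v.2 + cst z.2) v.2.
  apply: is_derive_eq; rewrite scaler0 add0r addr0.
  by rewrite /GRing.scale /= mulr1.
exact: h.
Qed.

Lemma is_derive_prod (R : realType) (V : normedModType R) (f g : V -> R) (z v : V) (df dg : R) :
  is_derive z v f df -> is_derive z v g dg ->
  is_derive z v (fun y => f y * g y) (df * g z + f z * dg).
Proof.
move=> hf hg; have h := is_deriveM hf hg.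
by apply: (@is_derive_eq _ _ _ _ _ _ _ _ h); rewrite addrC [in LHS]/GRing.scale /= mulrC.
Qed.

Lemma is_derive_inv (R : realType) (V : normedModType R) (f : V -> R) (z v : V) (df : R) :
  f z != 0 -> is_derive z v f df -> is_derive z v (fun y => (f y)^-1) (- df / f z ^+ 2).
Proof.
move=> f0 [fd fE]; split; first exact: derivableV.
by rewrite deriveV// fE [in LHS]/GRing.scale /= mulNr mulrC mulNr.
Qed.

Lemma is_derive_quot (R : realType) (V : normedModType R) (f g : V -> R) (z v : V) (df dg : R) :
  g z != 0 -> is_derive z v f df -> is_derive z v g dg ->
  is_derive z v (fun y => f y / g y) ((df * g z - f z * dg) / g z ^+ 2).
Proof.
move=> g0 hf hg; have h := is_derive_prod hf (is_derive_inv g0 hg).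
by apply: (@is_derive_eq _ _ _ _ _ _ _ _ h); field.
Qed.

(** The practical way to establish smoothness: exhibit the two partial
    derivatives and show that they are smooth. *)
Lemma Ck_onS (R : realType) (H : normedModType R) (k : nat) (U : set (R * R))
    (f fx fy : R * R -> H) :
  open U -> (forall z, U z -> {for z, continuous f}) ->
  (forall z, U z -> is_derive z ((1, 0) : R * R) f (fx z)) ->
  (forall z, U z -> is_derive z ((0, 1) : R * R) f (fy z)) ->
  Ck_on k U fx -> Ck_on k U fy -> Ck_on k.+1 U f.
Proof.
move=> oU cf dx dy kx ky; split; first exact: cf.
split.
- by move=> z Uz; have := dx _ Uz => ?; exact: ex_derive.
- by move=> z Uz; have := dy _ Uz => ?; exact: ex_derive.
- by apply: eq_Ck_on kx => // z Uz; apply: esym; exact: derive_of (dx z Uz).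
- by apply: eq_Ck_on ky => // z Uz; apply: esym; exact: derive_of (dy z Uz).
Qed.

Lemma Ck_onW (R : realType) (H : normedModType R) (k : nat) (U : set (R * R)) (f : R * R -> H) :
  Ck_on k.+1 U f -> Ck_on k U f.
Proof.
elim: k f => [|k IH] f [cf [dx dy fx fy]]; split; try exact: cf; first by [].
split; [exact: dx|exact: dy|exact: IH fx|exact: IH fy].
Qed.

Lemma Ck_on_cst (R : realType) (H : normedModType R) (k : nat) (U : set (R * R)) (c : H) :
  open U -> Ck_on k U (fun=> c).
Proof.
move=> oU; elim: k c => [|k IH] c.
  by split => // z _; exact: cvg_cst.
apply: (Ck_onS oU _ _ _ (IH 0) (IH 0)) => z _.
  exact: cvg_cst.
all: exact: is_derive_cst.
Qed.

Lemma Ck_on_fst (R : realType) (k : nat) (U : set (R * R)) : open U -> Ck_on k U (fun y => y.1).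
Proof.
move=> oU; case: k => [|k].
  by split; [move=> z _; exact: (@continuous_fst R R z)|].
apply: (Ck_onS oU _ _ _ (Ck_on_cst k _ oU) (Ck_on_cst k _ oU)) => z _.
  exact: continuous_fst.
all: exact: is_derive_fst.
Qed.

Lemma Ck_on_snd (R : realType) (k : nat) (U : set (R * R)) : open U -> Ck_on k U (fun y => y.2).
Proof.
move=> oU; case: k => [|k].
  by split; [move=> z _; exact: (@continuous_snd R R z)|].
apply: (Ck_onS oU _ _ _ (Ck_on_cst k _ oU) (Ck_on_cst k _ oU)) => z _.
  exact: continuous_snd.
all: exact: is_derive_snd.
Qed.

Lemma Ck_onD (R : realType) (H : normedModType R) (k : nat) (U : set (R * R)) (f g : R * R -> H) :
  open U -> Ck_on k U f -> Ck_on k U g -> Ck_on k U (fun y => f y + g y).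
Proof.
move=> oU fk gk; apply: eq_Ck_on (Ck_on_lincomb 1 1 oU fk gk) => // z _.
by rewrite !fctE !scale1r.
Qed.

Lemma Ck_onM (R : realType) (k : nat) (U : set (R * R)) (f g : R * R -> R) :
  open U -> Ck_on k U f -> Ck_on k U g -> Ck_on k U (fun y => f y * g y).
Proof.
move=> oU; elim: k f g => [|k IH] f g fk gk.
all: have cfg z : U z -> {for z, continuous (fun y => f y * g y)} by
  case: fk gk => cf _ [cg _] Uz; apply: cvgM; [exact: cf|exact: cg].
  by split.
have f' := Ck_onW fk; have g' := Ck_onW gk.
case: fk gk => _ [dfx dfy fx fy] [_ [dgx dgy gx gy]].
apply: (Ck_onS oU cfg
  (fun z Uz => is_derive_prod (derivableP (dfx z Uz)) (derivableP (dgx z Uz)))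
  (fun z Uz => is_derive_prod (derivableP (dfy z Uz)) (derivableP (dgy z Uz)))).
- by apply: Ck_onD => //; apply: IH.
- by apply: Ck_onD => //; apply: IH.
Qed.

Lemma Ck_onV (R : realType) (k : nat) (U : set (R * R)) (f : R * R -> R) :
  open U -> (forall z, U z -> f z != 0) -> Ck_on k U f -> Ck_on k U (fun y => (f y)^-1).
Proof.
move=> oU f0; elim: k => [|k IH] fk.
all: have cf z : U z -> {for z, continuous (fun y => (f y)^-1)} by
  case: fk => cf _ Uz; apply: cvgV; [exact: f0|exact: cf].
  by split.
have fV := IH (Ck_onW fk).
case: fk => _ [dx dy fx fy].
have shape (g : R * R -> R) : Ck_on k U g -> Ck_on k U (fun z => - g z / f z ^+ 2).
  move=> gk; have := Ck_onM oU (Ck_onM oU (Ck_on_cst k (-1 : R) oU) gk) (Ck_onM oU fV fV).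
  by apply: eq_Ck_on => // z Uz; rewrite /= mulN1r -invfM -expr2.
apply: (Ck_onS oU cf
  (fun z Uz => is_derive_inv (f0 z Uz) (derivableP (dx z Uz)))
  (fun z Uz => is_derive_inv (f0 z Uz) (derivableP (dy z Uz)))); exact: shape.
Qed.

(** * The extremal harmonic function *)

Definition disk_gap (R : realType) (z : R * R) : R := 1 - z.1 ^+ 2 - z.2 ^+ 2.

(** On the disk this is [2 / pi] times the argument of [(1 + z) / (1 - z)], since
    [1 + z] times the conjugate of [1 - z] is [1 - |z|^2 + 2 i t] for
    [z = s + i t]. *)
Definition extremal (R : realType) (z : R * R) : R := 2 / pi * atan (2 * z.2 / disk_gap z).

(** This is [|1 - z^2|^2], the common denominator of the partial derivatives of
    [extremal]. *)
Definition extremal_den (R : realType) (z : R * R) : R := disk_gap z ^+ 2 + 4 * z.2 ^+ 2.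

Section extremal.
Variable R : realType.
Implicit Types z v : R * R.

Lemma disk_gap_gt0 z : unit_disk z -> 0 < disk_gap z.
Proof. by rewrite /unit_disk /disk_gap /= => h; rewrite -addrA -opprD subr_gt0. Qed.

Lemma extremal_den_gt0 z : unit_disk z -> 0 < extremal_den z.
Proof.
move=> /disk_gap_gt0 g0; rewrite /extremal_den ltr_wpDr ?exprn_gt0//.
by rewrite mulr_ge0// sqr_ge0.
Qed.

Lemma continuous_disk_gap : continuous (@disk_gap R).
Proof.
move=> z; have c1 := @continuous_fst R R z; have c2 := @continuous_snd R R z.
by apply: cvgB; [apply: cvgB; [exact: cvg_cst|exact: (cvgM c1 c1)]|exact: (cvgM c2 c2)].
Qed.

Lemma open_unit_disk : open (@unit_disk R).
Proof.
rewrite (_ : unit_disk (R:=R) = disk_gap (R:=R) @^-1` [set x | 0 < x]).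
  apply: open_comp; last exact: open_gt.
  by move=> z _; exact: continuous_disk_gap.
by apply/seteqP; split=> z; rewrite /unit_disk /disk_gap /= -addrA -opprD subr_gt0.
Qed.

Lemma is_derive_disk_gap z v : is_derive z v (@disk_gap R) (- (2 * (z.1 * v.1 + z.2 * v.2))).
Proof.
have d1 := is_derive_fst z v; have d2 := is_derive_snd z v.
have h := is_deriveB (is_deriveB (is_derive_cst (1 : R) z v) (is_derive_prod d1 d1))
   (is_derive_prod d2 d2).
by apply: (@is_derive_eq _ _ _ _ _ _ _ _ h); ring.
Qed.

Lemma is_derive_extremal_den z v : is_derive z v (@extremal_den R)
  (- 4 * disk_gap z * (z.1 * v.1 + z.2 * v.2) + 8 * z.2 * v.2).
Proof.
have g := is_derive_disk_gap z v; have d2 := is_derive_snd z v.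
have h := is_deriveD (is_derive_prod g g)
  (is_derive_prod (is_derive_cst (4 : R) z v) (is_derive_prod d2 d2)).
by apply: (@is_derive_eq _ _ _ _ _ _ _ _ h); ring.
Qed.

Lemma is_derive_extremal z v : unit_disk z -> is_derive z v (@extremal R)
  (2 / pi * ((2 * (disk_gap z + 2 * z.2 ^+ 2) * v.2 + 4 * (z.1 * z.2) * v.1) / extremal_den z)).
Proof.
move=> Uz; have g0 := lt0r_neq0 (disk_gap_gt0 Uz).
have n0 := lt0r_neq0 (extremal_den_gt0 Uz).
have num := is_derive_prod (is_derive_cst (2 : R) z v) (is_derive_snd z v).
have q := is_derive_quot g0 num (is_derive_disk_gap z v).
have h := is_derive_prod (is_derive_cst (2 / pi : R) z v)
  (is_derive_comp1 q (is_derive1_atan (2 * z.2 / disk_gap z))).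
apply: (@is_derive_eq _ _ _ _ _ _ _ _ h); rewrite mul0r add0r; congr (_ * _).
have -> : 1 + (2 * z.2 / disk_gap z) ^+ 2 = extremal_den z / disk_gap z ^+ 2.
  by rewrite /extremal_den; field.
by field; rewrite n0 g0.
Qed.

Definition extremal_dx z : R := 2 / pi * (4 * (z.1 * z.2) / extremal_den z).

Definition extremal_dy z : R :=
  2 / pi * (2 * (disk_gap z + 2 * z.2 ^+ 2) / extremal_den z).

Lemma is_derive_extremal_dx z :
  unit_disk z -> is_derive z ((1, 0) : R * R) (@extremal R) (extremal_dx z).
Proof.
by move=> Uz; apply: (@is_derive_eq _ _ _ _ _ _ _ _ (is_derive_extremal _ Uz));
  rewrite /= mulr0 mulr1 add0r.
Qed.

Lemma is_derive_extremal_dy z :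
  unit_disk z -> is_derive z ((0, 1) : R * R) (@extremal R) (extremal_dy z).
Proof.
by move=> Uz; apply: (@is_derive_eq _ _ _ _ _ _ _ _ (is_derive_extremal _ Uz));
  rewrite /= mulr0 mulr1 addr0.
Qed.

Lemma Ck_on_extremal_partials k :
  Ck_on k (@unit_disk R) extremal_dx /\ Ck_on k (@unit_disk R) extremal_dy.
Proof.
have oU := open_unit_disk.
have c0 (c : R) := Ck_on_cst k c oU.
have f1 := @Ck_on_fst R k _ oU; have f2 := @Ck_on_snd R k _ oU.
have gk : Ck_on k (@unit_disk R) (@disk_gap R).
  have := Ck_onD oU (Ck_onD oU (c0 1) (Ck_onM oU (c0 (-1)) (Ck_onM oU f1 f1)))
     (Ck_onM oU (c0 (-1)) (Ck_onM oU f2 f2)).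
  by apply: eq_Ck_on => // z _; rewrite /disk_gap !mulN1r.
have nk : Ck_on k (@unit_disk R) (@extremal_den R).
  exact: (Ck_onD oU (Ck_onM oU gk gk) (Ck_onM oU (c0 4) (Ck_onM oU f2 f2))).
have nVk := Ck_onV oU (fun z Uz => lt0r_neq0 (extremal_den_gt0 Uz)) nk.
split; apply: (Ck_onM oU (c0 (2 / pi))); apply: (Ck_onM oU _ nVk).
  exact: (Ck_onM oU (c0 4) (Ck_onM oU f1 f2)).
exact: (Ck_onM oU (c0 2) (Ck_onD oU gk (Ck_onM oU (c0 2) (Ck_onM oU f2 f2)))).
Qed.

Lemma harmonic_extremal : harmonic_on (@unit_disk R) (@extremal R).
Proof.
have oU := open_unit_disk; have [kx ky] := Ck_on_extremal_partials 1.
split.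
  apply: (Ck_onS oU _ is_derive_extremal_dx is_derive_extremal_dy kx ky) => z Uz.
  have g0 := lt0r_neq0 (disk_gap_gt0 Uz).
  apply: cvgM; first exact: cvg_cst.
  apply: continuous_cvg; first exact: continuous_atan.
  apply: cvgM; first by apply: cvgM; [exact: cvg_cst|exact: (@continuous_snd R R z)].
  by apply: cvgV => //; exact: continuous_disk_gap.
move=> z Uz; have n0 := lt0r_neq0 (extremal_den_gt0 Uz).
have xx : partial_x (partial_x (@extremal R)) z =
  2 / pi * ((4 * z.2 * extremal_den z + 16 * (z.1 ^+ 2 * z.2) * disk_gap z) / extremal_den z ^+ 2).
  have num := is_derive_prod (is_derive_cst (4 : R) z ((1, 0) : R * R))
    (is_derive_prod (is_derive_fst z (1, 0)) (is_derive_snd z (1, 0))).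
  have h := is_derive_prod (is_derive_cst (2 / pi : R) z ((1, 0) : R * R))
    (is_derive_quot n0 num (is_derive_extremal_den z (1, 0))).
  transitivity ('D_((1, 0) : R * R) extremal_dx z).
    apply: near_eq_derive; apply: open_near_eq oU Uz _ => y Uy.
    exact: derive_of (is_derive_extremal_dx Uy).
  rewrite (derive_of h) /=; rewrite mul0r add0r; congr (_ * _).
  by field.
have yy : partial_y (partial_y (@extremal R)) z =
  2 / pi * ((4 * z.2 * extremal_den z -
    2 * (disk_gap z + 2 * z.2 ^+ 2) * (8 * z.2 - 4 * disk_gap z * z.2)) / extremal_den z ^+ 2).
  have num := is_derive_prod (is_derive_cst (2 : R) z ((0, 1) : R * R))
    (is_deriveD (is_derive_disk_gap z (0, 1))
      (is_derive_prod (is_derive_cst (2 : R) z ((0, 1) : R * R))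
      (is_derive_prod (is_derive_snd z (0, 1)) (is_derive_snd z (0, 1))))).
  have h := is_derive_prod (is_derive_cst (2 / pi : R) z ((0, 1) : R * R))
    (is_derive_quot n0 num (is_derive_extremal_den z (0, 1))).
  transitivity ('D_((0, 1) : R * R) extremal_dy z).
    apply: near_eq_derive; apply: open_near_eq oU Uz _ => y Uy.
    exact: derive_of (is_derive_extremal_dy Uy).
  rewrite (derive_of h) /=; rewrite mul0r add0r; congr (_ * _).
  by rewrite !fctE; field.
rewrite /laplacian xx yy -mulrDr -mulrDl.
set m := (X in _ * (X / _)).
suff -> : m = 0 by rewrite mul0r mulr0.
by rewrite /m /extremal_den /disk_gap; ring.
Qed.

End extremal.

(** * Comparison on the upper half disk *)

Lemma Ck_on_subset (R : realType) (H : normedModType R) (k : nat) (U V : set (R * R))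
    (f : R * R -> H) :
  V `<=` U -> Ck_on k U f -> Ck_on k V f.
Proof.
move=> VU; elim: k f => [|k IH] f [cf fk].
  by split; [move=> z /VU; exact: cf|].
case: fk => dx dy fx fy; split; first by move=> z /VU; exact: cf.
split; [by move=> z /VU; exact: dx|by move=> z /VU; exact: dy|exact: IH fx|exact: IH fy].
Qed.

Lemma harmonic_on_subset (R : realType) (H : normedModType R) (U V : set (R * R)) (f : R * R -> H) :
  V `<=` U -> harmonic_on U f -> harmonic_on V f.
Proof.
by move=> VU [f2 lf]; split; [exact: Ck_on_subset f2|move=> z /VU; exact: lf].
Qed.

Lemma laplacian_local_max (R : realType) (U : set (R * R)) (f : R * R -> R) z :
  open U -> Ck_on 2 U f -> U z -> (\forall y \near z, f y <= f z) -> laplacian f z <= 0.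
Proof.
move=> oU [_ [dx dy [_ [xx _ _ _]] [_ [_ yy _ _]]]] Uz fmax.
have nU : \forall y \near z, U y by exact: open_nbhs_nbhs.
rewrite /laplacian -[X in _ <= X]addr0; apply: lerD.
  apply: second_derivative_test => //; last exact: xx.
  by apply: filterS nU => y; exact: dx.
apply: second_derivative_test => //; last exact: yy.
by apply: filterS nU => y; exact: dy.
Qed.

Lemma compact_preimage (T S : topologicalType) (A : set T) (B : set S) (f : T -> S) :
  compact A -> closed B -> (forall x, A x -> {for x, continuous f}) ->
  compact (A `&` f @^-1` B).
Proof.
move=> cA cB cf F FF FAB.
have [x [Ax clx]] : A `&` cluster F !=set0.
  by apply: cA; apply: filterS FAB => y [].
exists x; split => //; split => //.
apply: cB => N /(cf _ Ax) fN.
by have [y [[_ fy] Ny]] := clx _ _ FAB fN; exists (f y).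
Qed.

(** The right-hand side loses its meaning at [x = 0], whereas the left-hand side
    is continuous there. This is what makes the comparison with [extremal]
    meaningful up to the circle, including the end points of the diameter,
    where [extremal] has no limit. *)
Lemma sin_cos_ge0_atan (R : realType) (psi x y : R) : 0 < x -> 0 <= psi < pi / 2 ->
  (0 <= sin psi * x - cos psi * y) = (atan (y / x) <= psi).
Proof.
move=> x0 /andP[p0 p1].
have pI : psi \in `](- (pi / 2)), (pi / 2)[.
  by rewrite in_itv /= p1 andbT (lt_le_trans _ p0)// oppr_lt0 divr_gt0// pi_gt0.
have c0 : 0 < cos psi by apply: cos_gt0_pihalf; move: pI; rewrite in_itv.
rewrite -{3}(tanK pI) (le_mono (@lt_atan R)) /tan ler_pdivrMr// mulrAC ler_pdivlMr//.
by rewrite subr_ge0 mulrC.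
Qed.

Lemma closed_half_disk_compact (R : realType) :
  compact [set z : R * R | 0 <= disk_gap z /\ 0 <= z.2].
Proof.
have seg (a b : R) := @segment_compact R a b.
have cbox : compact (`[-1, 1]%classic `*` `[0, 1]%classic : set (R * R)).
  by apply: compact_setX.
have -> : [set z : R * R | 0 <= disk_gap z /\ 0 <= z.2] =
   (`[-1, 1]%classic `*` `[0, 1]%classic) `&` @disk_gap R @^-1` [set x | 0 <= x].
  apply/seteqP; split => z /=; rewrite !in_itv /= /disk_gap.
    move=> [g0 z0]; split => //.
    have z1 : z.1 ^+ 2 <= 1 by nra.
    have z2 : z.2 ^+ 2 <= 1 by nra.
    by split; apply/andP; split=> //; nra.
  by move=> [[_ /andP[z0 _]] g0].
apply: (compact_preimage cbox); first exact: closed_ge.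
by move=> z _; exact: continuous_disk_gap.
Qed.

Lemma extremal_ge0 (R : realType) (z : R * R) : 0 <= disk_gap z -> 0 <= z.2 -> 0 <= extremal z.
Proof.
move=> g0 z0; apply: mulr_ge0; first by rewrite divr_ge0// pi_ge0.
rewrite -(atan0 R) (le_mono (@lt_atan R)); by rewrite divr_ge0// mulr_ge0.
Qed.

(** Suppose that [w - extremal] takes the value [2 d > 0]. The set [K] where
    [d <= w - extremal] is compact, once the inequality is written in the form
    of [sin_cos_ge0_atan], and it touches neither the diameter, where [w = 0],
    nor the circle, where [extremal] has the limit [1 > w] above the diameter
    and where [w = 0] at the two end points. So [w - extremal + d / 2 * t^2]
    attains its maximum over [K] at an interior point of the half disk. The
    added term is small enough for the maximum to satisfy [d < w - extremal],
    hence to be a local maximum, although the Laplacian there is [d > 0]. *)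
Lemma half_disk_comparison (R : realType) (V : set (R * R)) (w : R * R -> R) z0 :
  open V -> (forall z, 0 <= disk_gap z -> V z) -> harmonic_on V w ->
  (forall z, 0 <= disk_gap z -> w z < 1) ->
  (forall s : R, 0 <= disk_gap (s, 0) -> w (s, 0) = 0) ->
  unit_disk z0 -> 0 <= z0.2 -> w z0 <= extremal z0.
Proof.
move=> oV dV hw w1 wa U0 z00; rewrite leNgt; apply/negP => lt0.
pose d := (w z0 - extremal z0) / 2.
have d0 : 0 < d by rewrite divr_gt0// subr_gt0.
(* the angle to be compared with [pi / 2 * extremal] *)
pose psi (z : R * R) := pi / 2 * (w z - d).
pose k (z : R * R) := sin (psi z) * disk_gap z - cos (psi z) * (2 * z.2).
pose A := [set z : R * R | 0 <= disk_gap z /\ 0 <= z.2].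
pose K := (A `&` w @^-1` [set x | d <= x]) `&` k @^-1` [set x | 0 <= x].
have pi2 : 0 < pi / 2 :> R by rewrite divr_gt0// pi_gt0.
have wc (z : R * R) : A z -> {for z, continuous w}.
  by move=> [g0 _]; case: hw => [[cw _] _]; apply: cw; exact: dV.
have psic (z : R * R) : A z -> {for z, continuous psi}.
  move=> Az; apply: cvgM; first exact: cvg_cst.
  by apply: cvgB; [exact: wc|exact: cvg_cst].
have kc (z : R * R) : A z -> {for z, continuous k}.
  move=> Az; apply: cvgB; apply: cvgM.
  - by apply: continuous_cvg; [exact: continuous_sin|exact: psic].
  - exact: continuous_disk_gap.
  - by apply: continuous_cvg; [exact: continuous_cos|exact: psic].
  - by apply: cvgM; [exact: cvg_cst|exact: (@continuous_snd R R z)].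
have cK : compact K.
  apply: compact_preimage; [|exact: closed_ge|by move=> z [/kc]].
  by apply: compact_preimage; [exact: closed_half_disk_compact|exact: closed_ge|exact: wc].
have psiI (z : R * R) : 0 <= disk_gap z -> d <= w z -> 0 <= psi z < pi / 2.
  move=> g0 dw; rewrite /psi; apply/andP; split.
    by rewrite mulr_ge0 ?subr_ge0// ltW.
  rewrite -[ltRHS]mulr1 ltr_pM2l// (lt_trans _ (w1 _ g0))// ltrBlDr ltrDl.
  exact: d0.
have extE (z : R * R) : atan (2 * z.2 / disk_gap z) = pi / 2 * extremal z.
  have pi0 : pi != 0 :> R by rewrite gt_eqF// pi_gt0.
  have cancel (p : R) : p != 0 -> p / 2 * (2 / p) = 1 by move=> ?; field.
  by rewrite /extremal [RHS]mulrA (cancel _ pi0) mul1r.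
have KE (z : R * R) : 0 < disk_gap z -> 0 <= z.2 -> K z <-> d <= w z - extremal z.
  move=> g0 z2; have e0 := extremal_ge0 (ltW g0) z2.
  have kE : d <= w z -> (0 <= k z) = (d <= w z - extremal z).
    move=> dw; rewrite /k (sin_cos_ge0_atan _ g0 (psiI _ (ltW g0) dw)) extE.
    by rewrite /psi ler_pM2l// lerBrDr addrC -lerBrDr.
  split=> [[[_ /= dw] /=]|dw]; first by rewrite kE.
  have dw' : d <= w z by rewrite (le_trans dw)// gerBl.
  by split; [split => //; split => //; exact: ltW|rewrite /= kE].
have Kint (z : R * R) : K z -> 0 < disk_gap z /\ 0 < z.2.
  move=> [[[g0 z2] /= dw] /= k0].
  have z2pos : 0 < z.2.
    rewrite lt_neqAle z2 andbT; apply/eqP => z20.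
    have zE : z = (z.1, 0) by rewrite z20; case: (z).
    by move: dw; rewrite zE wa -?zE// leNgt d0.
  split=> //; rewrite lt_neqAle g0 andbT; apply/eqP => g00.
  have /andP[p0 p1] := psiI _ g0 dw.
  have c0 : 0 < cos (psi z).
    by apply: cos_gt0_pihalf; rewrite p1 andbT (lt_le_trans _ p0)// oppr_lt0.
  move: k0; rewrite /k -g00 mulr0 sub0r oppr_ge0 leNgt.
  by rewrite !mulr_gt0.
have gU (z : R * R) : 0 < disk_gap z -> unit_disk z.
  by rewrite /unit_disk /disk_gap /= -addrA -opprD subr_gt0.
pose O := V `&` @unit_disk R.
have oO : open O by apply: openI => //; exact: open_unit_disk.
have KO (z : R * R) : K z -> O z.
  by move=> /Kint[g0 _]; split; [apply: dV; exact: ltW|exact: gU].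
pose h : R * R -> R := 1 *: w + (- 1) *: @extremal R.
have hh : harmonic_on O h.
  apply: harmonic_on_lincomb oO _ _; first by apply: harmonic_on_subset hw => z [].
  by apply: (harmonic_on_subset _ (@harmonic_extremal R)) => z [].
have hE (z : R * R) : h z = w z - extremal z.
  by rewrite -[h z]/(1 * w z + (- 1) * extremal z) mul1r mulN1r.
pose sq (z : R * R) : R := z.2 * z.2.
have sq2 : Ck_on 2 O sq := Ck_onM oO (@Ck_on_snd R 2 _ oO) (@Ck_on_snd R 2 _ oO).
have sqL (z : R * R) : laplacian sq z = 2.
  have dsq (y v : R * R) := is_derive_prod (is_derive_snd y v) (is_derive_snd y v).
  have sx : partial_x sq = fun=> 0.
    by apply/funext => y; rewrite /partial_x (derive_of (dsq _ _)) /= mul0r mulr0 addr0.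
  have sy : partial_y sq = fun y => 2 * y.2.
    by apply/funext => y; rewrite /partial_y (derive_of (dsq _ _)) /=; ring.
  have d2 := is_derive_prod (is_derive_cst (2 : R) z ((0, 1) : R * R)) (is_derive_snd z (0, 1)).
  rewrite /laplacian sx sy /partial_x derive_cst add0r /partial_y (derive_of d2) /=.
  by rewrite mul0r add0r mulr1.
pose f := 1 *: h + (d / 2) *: sq.
have fE (z : R * R) : f z = w z - extremal z + d / 2 * z.2 ^+ 2.
  by rewrite -[f z]/(1 * h z + d / 2 * (z.2 * z.2)) mul1r hE.
have [h2 hlap] := hh.
have f2 : Ck_on 2 O f := Ck_on_lincomb 1 (d / 2) oO h2 sq2.
have dE : w z0 - extremal z0 = 2 * d by rewrite /d mulrC divfK.
have K0 : K z0.
  by apply/KE => //; [exact: disk_gap_gt0|rewrite dE; lra].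
have [zm Kzm zmax] : exists2 c, c \in K & forall t, t \in K -> f t <= f c.
  apply: compact_EVT_max => //; first by exists z0.
  apply: continuous_in_subspaceT => z /set_mem /KO.
  by case: f2 => cf _; exact: cf.
have {}Kzm := set_mem Kzm.
have Oz := KO _ Kzm; have [gz zmp] := Kint _ Kzm.
have hlarge : d < h zm.
  have := zmax z0 (mem_set K0); rewrite !fE dE hE.
  have := sqr_ge0 z0.2; have : zm.2 ^+ 2 < 1 by move: gz; rewrite /disk_gap; nra.
  by nra.
have hc : {for zm, continuous h} by case: h2 => [cf _]; exact: cf.
have fmax : \forall y \near zm, f y <= f zm.
  have nh : \forall y \near zm, d < h y by exact: (cvgr_gt _ hc).
  have n2 : \forall y \near zm, 0 < y.2 by exact: (cvgr_gt _ (@continuous_snd R R zm)).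
  have nO : \forall y \near zm, O y by exact: open_nbhs_nbhs.
  apply: filterS3 nh n2 nO => y hy y2 [Vy Uy].
  apply/zmax/mem_set/KE; [exact: disk_gap_gt0|exact: ltW|by rewrite -hE ltW].
have := laplacian_local_max oO f2 Oz fmax.
rewrite (laplacian_lincomb 1 (d / 2) oO h2 sq2 Oz) hlap//.
by rewrite scaler0 add0r sqL [_ *: _]divfK// leNgt d0.
Qed.

(** * The derivative bound at the origin *)

Lemma derive_ge0_right (R : realType) (V : normedModType R) (f : V -> R) (v : V) :
  derivable f 0 v -> f 0 = 0 -> (\forall t \near (0 : R), 0 < t -> 0 <= f (t *: v)) ->
  0 <= 'D_v f 0.
Proof.
move=> df f0 fpos; rewrite leNgt; apply/negP => neg.
have : \forall h \near 0^', h^-1 *: (f (h *: v + 0) - f 0) < 0 by exact: (cvgr_lt _ df).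
rewrite /dnbhs near_withinE => qneg.
have /nbhs_norm0P[e /= e0 eP] : \forall t \near (0 : R), (0 < t -> 0 <= f (t *: v)) /\
    (t != 0 -> t^-1 *: (f (t *: v + 0) - f 0) < 0) by exact: filterI fpos qneg.
have e20 : 0 < e / 2 by rewrite divr_gt0.
have e2 : `|e / 2| < e by rewrite gtr0_norm//; lra.
have [/(_ e20) h1 /(_ (lt0r_neq0 e20))] := eP _ e2.
rewrite addr0 f0 subr0 [_ *: _ in X in X -> _]/GRing.scale /= pmulr_rlt0 ?invr_gt0// ltNge.
by rewrite h1.
Qed.

Lemma scalar_pair (R : realType) (r x y : R) : r *: ((x, y) : R * R) = (r * x, r * y).
Proof. by []. Qed.

Lemma unit_disk0 (R : realType) : unit_disk (0 : R * R).
Proof. by rewrite /unit_disk /= !expr0n /= addr0. Qed.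

Lemma extremal_dy0 (R : realType) : extremal_dy (0 : R * R) = 4 / pi.
Proof.
have pi0 : pi != 0 :> R by rewrite gt_eqF// pi_gt0.
have g1 : disk_gap (0 : R * R) = 1 by rewrite /disk_gap /= expr0n /= !subr0.
rewrite /extremal_dy /extremal_den g1 /= expr0n /= !mulr0 !addr0 expr1n divr1.
by rewrite mulr1 mulrAC -natrM.
Qed.

Lemma odd_harmonic_derivative (R : realType) (V : set (R * R)) (w : R * R -> R) :
  open V -> (forall z, 0 <= disk_gap z -> V z) -> harmonic_on V w ->
  (forall z, 0 <= disk_gap z -> w z < 1) ->
  (forall s : R, 0 <= disk_gap (s, 0) -> w (s, 0) = 0) ->
  partial_y w 0 <= 4 / pi.
Proof.
move=> oV dV hw w1 wa.
have U0 := unit_disk0 R.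
have g0 : 0 <= disk_gap (0 : R * R) by exact/ltW/disk_gap_gt0.
have dw : derivable w 0 (0, 1) by case: hw => [[_ [_ dy _ _]] _]; exact/dy/dV.
have de := is_derive_extremal_dy U0.
have h := is_deriveB de (derivableP dw).
rewrite -subr_ge0 -extremal_dy0 -[X in 0 <= X](derive_of h).
apply: derive_ge0_right; first exact: ex_derive.
  have e0 : extremal (0 : R * R) = 0 by rewrite /extremal /= mulr0 mul0r atan0 mulr0.
  have w0 : w 0 = 0 by exact: (wa 0 g0).
  by rewrite -[LHS]/(extremal (0 : R * R) - w 0) e0 w0 subr0.
have : \forall t \near (0 : R), t < 1 by exact: lt_nbhsl.
apply: filterS => t t1 t0.
have tE : t *: ((0, 1) : R * R) = (0, t) by rewrite scalar_pair mulr0 mulr1.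
rewrite tE -[leRHS]/(extremal (0, t) - w (0, t)) subr_ge0.
apply: half_disk_comparison oV dV hw w1 wa _ _; last exact: ltW.
by rewrite /unit_disk /= expr0n /= add0r; nra.
Qed.

(** The frame consists of [r v] and of [v] turned by a right angle and dilated
    by [r]; replacing [r v] by [- r v] gives the mirror image. Both are conformal
    with the factor [c = r^2 |v|^2 < 1], which leaves room around the closed unit
    disk. *)
Lemma harmonic_ball_derivative (R : realType) (H : normedModType R) (F : R * R -> H) (v : R * R) :
  norming H -> (forall z, unit_disk z -> `|F z| < 1) -> harmonic_on (@unit_disk R) F ->
  v.1 ^+ 2 + v.2 ^+ 2 <= 1 -> `|'d F (0 : R * R) v| <= 4 / pi.
Proof.
move=> nH F1 hF v1.
have oU := @open_unit_disk R.
have U0 := unit_disk0 R.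
have [F2 _] := hF.
have dF := Ck_on1_is_diff nH oU (Ck_onW F2) U0.
have dF' : differentiable F (0 : R * R) by exact: ex_diff.
have [l [l1 lv]] := nH ('d F (0 : R * R) v).
have lc := continuous_contraction l1.
have scaled (r : R) : 0 < r < 1 -> r * `|'d F (0 : R * R) v| <= 4 / pi.
  move=> /andP[r0 r1].
  pose c := r ^+ 2 * (v.1 ^+ 2 + v.2 ^+ 2).
  pose a : R * R := (r * v.2, - (r * v.1)).
  pose V := [set z : R * R | c * (z.1 ^+ 2 + z.2 ^+ 2) < 1].
  have rotated (s : R) : s ^+ 2 = r ^+ 2 ->
     [/\ forall z, V z -> unit_disk (frame a (s *: v) z),
      a.1 ^+ 2 + (s *: v).1 ^+ 2 = c, a.2 ^+ 2 + (s *: v).2 ^+ 2 = c,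
      a.1 * a.2 + (s *: v).1 * (s *: v).2 = 0 &
      partial_y (l \o (F \o frame a (s *: v))) 0 = s * `|'d F (0 : R * R) v| ].
    move=> s2; split.
    - move=> z; rewrite /V /unit_disk /frame /a /= /GRing.scale /= => Vz.
      suff -> : (z.1 * (r * v.2) + z.2 * (s * v.1)) ^+ 2 +
        (z.1 * - (r * v.1) + z.2 * (s * v.2)) ^+ 2 = c * (z.1 ^+ 2 + z.2 ^+ 2) by [].
      transitivity ((v.1 ^+ 2 + v.2 ^+ 2) * (r ^+ 2 * z.1 ^+ 2 + s ^+ 2 * z.2 ^+ 2)); first by ring.
      by rewrite s2 /c; ring.
    - rewrite /a /= /GRing.scale /= !exprMn s2 /c; ring.
    - rewrite /a /= /GRing.scale /= sqrrN !exprMn s2 /c; ring.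
    - rewrite /a /= /GRing.scale /=.
      transitivity ((s ^+ 2 - r ^+ 2) * (v.1 * v.2)); first by ring.
      by rewrite s2 subrr mul0r.
    - have f0 : frame a (s *: v) 0 = 0 by rewrite /frame !scale0r addr0.
      have dFs : derivable F (frame a (s *: v) 0) (s *: v) by rewrite f0; exact: diff_derivable.
      have dT := is_derive_frame_y dFs.
      rewrite /partial_y (derive_of (is_derive_linear_comp lc (@ex_derive _ _ _ _ _ _ _ dT))).
      by rewrite (derive_of dT) f0 deriveE// linearZ linearZ_LR lv.
  have [VU c1 c2 c12 yp] := rotated r erefl.
  have [VU' c1' c2' c12' yn] := rotated (- r) (sqrrN r).
  have oV : open V.
    apply: (@open_comp _ _ (fun z : R * R => c * (z.1 * z.1 + z.2 * z.2)) [set x | x < 1]);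
      last exact: open_lt.
    move=> z _; have k1 := @continuous_fst R R z; have k2 := @continuous_snd R R z.
    by apply: cvgM; [exact: cvg_cst|exact: (cvgD (cvgM k1 k1) (cvgM k2 k2))].
  pose w : R * R -> R := 2^-1 *: (l \o (F \o frame a (r *: v)))
    + (- 2^-1) *: (l \o (F \o frame a (- r *: v))).
  have hp := harmonic_on_linear_comp lc oV (harmonic_on_frame nH oU oV VU c1 c2 c12 hF).
  have hn := harmonic_on_linear_comp lc oV (harmonic_on_frame nH oU oV VU' c1' c2' c12' hF).
  have hw : harmonic_on V w := harmonic_on_lincomb _ _ oV hp hn.
  have wE (z : R * R) : w z = (l (F (frame a (r *: v) z)) - l (F (frame a (- r *: v) z))) / 2.
    rewrite -[w z]/(2^-1 * l (F (frame a (r *: v) z)) + - 2^-1 * l (F (frame a (- r *: v) z))).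
    by rewrite mulNr -mulrBr mulrC.
  have dV (z : R * R) : 0 <= disk_gap z -> V z.
    rewrite /disk_gap /V /= => g0.
    have c0 : 0 <= c by rewrite mulr_ge0 ?addr_ge0 ?sqr_ge0.
    have cr : c <= r ^+ 2 by rewrite -[leRHS]mulr1 ler_wpM2l ?sqr_ge0.
    have rr : r ^+ 2 < 1 by rewrite expr_lt1// ltW.
    apply: le_lt_trans (le_lt_trans cr rr); rewrite -[leRHS]mulr1 ler_wpM2l//; lra.
  have V0 : V 0 by rewrite /V /= !expr0n /= addr0 mulr0.
  have -> : r * `|'d F (0 : R * R) v| = partial_y w 0.
    have dp : derivable (l \o (F \o frame a (r *: v))) 0 (0, 1).
      by case: hp => [[_ [_ dy _ _]] _]; exact: dy.
    have dn : derivable (l \o (F \o frame a (- r *: v))) 0 (0, 1).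
      by case: hn => [[_ [_ dy _ _]] _]; exact: dy.
    rewrite /partial_y (derive_of (is_derive_lincomb _ _ dp dn)).
    move: yp yn; rewrite /partial_y => -> ->.
    rewrite /GRing.scale /=; lra.
  apply: (odd_harmonic_derivative oV dV hw) => [z /dV Vz|s _].
    rewrite wE.
    have := le_lt_trans (l1 _) (F1 _ (VU _ Vz)); have := le_lt_trans (l1 _) (F1 _ (VU' _ Vz)).
    rewrite !ltr_norml => /andP[A _] /andP[_ B]; lra.
  by rewrite wE /frame /= !scale0r subrr mul0r.
(* let [r] tend to [1]: the midpoint of [m / x] and [1] contradicts [scaled] *)
rewrite leNgt; apply/negP.
set x := `|_| in scaled *; set m := 4 / pi in scaled * => mx.
have m0 : 0 < m by rewrite divr_gt0// pi_gt0.
have x0 : 0 < x by exact: lt_trans mx.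
have mx1 : m / x < 1 by rewrite ltr_pdivrMr// mul1r.
have mx0 : 0 < m / x by rewrite divr_gt0.
have : (m / x + 1) / 2 * x <= m by apply: scaled; apply/andP; split; lra.
have -> : (m / x + 1) / 2 * x = (m + x) / 2 by field; rewrite gt_eqF.
lra.
Qed.

(** * Sharpness and the theorem *)

Lemma extremal_norm_lt1 (R : realType) (z : R * R) : `|extremal z| < 1.
Proof.
have pi0 := pi_gt0 R.
rewrite /extremal normrM ger0_norm ?divr_ge0 ?pi_ge0// mulrAC ltr_pdivrMr// mul1r.
rewrite mulrC -ltr_pdivlMr// ltr_norml atan_ltpi2 andbT.
exact: atan_gtNpi2.
Qed.

Lemma op_norm_le (R : realType) (H : normedModType R) (L : R * R -> H) (m : R) :
  (forall v, v.1 ^+ 2 + v.2 ^+ 2 <= 1 -> `|L v| <= m) -> op_norm L <= m.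
Proof.
move=> Lm; apply: ge_sup; last by move=> _ [v v1 <-]; exact: Lm.
by exists `|L 0|; exists 0 => //=; rewrite !expr0n /= addr0.
Qed.

(** The differential at [0] sends [v] to [v.2 * (4 / pi)] times [x], so its norm
    is attained at the second basis vector. *)
Lemma extremal_multiple_sharp (R : realType) (H : normedModType R) (x : H) :
  norming H -> `|x| = 1 ->
  let F := fun z : R * R => extremal z *: x in
  [/\ forall z, unit_disk z -> `|F z| < 1, harmonic_on (@unit_disk R) F, F 0 = 0 &
      op_norm ('d F (0 : R * R)) = 4 / pi].
Proof.
move=> nH x1 F.
have oU := @open_unit_disk R.
have lin : linear (fun c : R => c *: x) by move=> c a b; rewrite scalerDl scalerA.
pose m := GRing.isLinear.Build _ _ _ _ _ lin.
pose l : {linear R -> H} := HB.pack (fun c : R => c *: x) m.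
have lc : continuous l.
  by apply: continuous_contraction => c; rewrite /= normrZ x1 mulr1.
have hF : harmonic_on (@unit_disk R) F := harmonic_on_linear_comp lc oU (@harmonic_extremal R).
have [F2 _] := hF.
have dF := Ck_on1_is_diff nH oU (Ck_onW F2) (unit_disk0 R).
have dx := is_derive_extremal_dx (unit_disk0 R).
have dy := is_derive_extremal_dy (unit_disk0 R).
have Fx : partial_x F 0 = 0.
  rewrite /partial_x (derive_of (is_derive_linear_comp lc (@ex_derive _ _ _ _ _ _ _ dx))).
  by rewrite (derive_of dx) /extremal_dx /= !mul0r !mulr0 mul0r mulr0 scale0r.
have Fy : partial_y F 0 = (4 / pi) *: x.
  rewrite /partial_y (derive_of (is_derive_linear_comp lc (@ex_derive _ _ _ _ _ _ _ dy))).
  by rewrite (derive_of dy) extremal_dy0.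
have dE (v : R * R) : `|'d F (0 : R * R) v| = `|v.2| * (4 / pi).
  have pi40 : 0 <= 4 / pi :> R by rewrite divr_ge0// pi_ge0.
  rewrite (@diff_val _ _ _ _ _ _ _ dF) Fx Fy scaler0 add0r.
  by rewrite normrZ [X in _ * X]normrZ x1 mulr1 (ger0_norm pi40).
have bound (v : R * R) : v.1 ^+ 2 + v.2 ^+ 2 <= 1 -> `|'d F (0 : R * R) v| <= 4 / pi.
  move=> v1; rewrite dE -[leRHS]mul1r ler_wpM2r ?divr_ge0 ?pi_ge0//.
  rewrite ler_norml; apply/andP; split; nra.
split => //.
- by move=> z _; rewrite /F normrZ x1 mulr1 extremal_norm_lt1.
- by rewrite /F /extremal /= mulr0 mul0r atan0 mulr0 scale0r.
- apply/eqP; rewrite eq_le op_norm_le//=.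
  apply: ub_le_sup; first by exists (4 / pi) => _ [v v1 <-]; exact: bound.
  by exists (0, 1); rewrite /= ?expr0n ?expr1n ?add0r// dE normr1 mul1r.
Qed.

Unset Implicit Arguments.
Set Strict Implicit.
(* The real Hilbert space is a complete normed space H whose norm comes from
   the inner product dot. *)
Theorem proposition6p1 (R : realType) (H : completeNormedModType R)
    (dot : {dot H for idfun}) (dot_norm : forall x : H, `|x| ^+ 2 = dot x x) :
  (forall F : R * R -> H,
     (forall z, unit_disk z -> `|F z| < 1) ->
     harmonic_on (@unit_disk R) F ->
     F 0 = 0 ->
     op_norm ('d F (0 : R * R)) <= 4 / pi) /\
  ((exists x : H, x != 0) ->
   exists F : R * R -> H,
     [/\ forall z, unit_disk z -> `|F z| < 1,
         harmonic_on (@unit_disk R) F,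
         F 0 = 0 &
         op_norm ('d F (0 : R * R)) = 4 / pi]).
Proof.
have nH := hilbert_norming dot_norm.
split=> [F F1 hF _|[x x0]].
  by apply: op_norm_le => v; exact: harmonic_ball_derivative.
exists (fun z => extremal z *: (`|x|^-1 *: x)); apply: extremal_multiple_sharp nH _.
by rewrite normrZ normfV normr_id mulVf// normr_eq0.
Qed.
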